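(* Let $S=(S_p,I_F)$ and $S'=(S_p,I_F')$ be canonical Local Friendliness scenarios with the same public scenario $S_p=(I_A,M,O)$, $N=|I_A|$, and with $I_F\neq I_F'$. If $I_F\not\subset I_F'$ and $I_F'\not\subset I_F$, then exactly one of the following three conditions holds: (i) $|I_F|=|I_F'|=N-1$, $|M_i|=2$ for all $i\in I_A$, and $\mathcal{LF}(S)=\mathcal{LF}(S')=\mathcal{B}(S_p)$; (ii) $\mathcal{B}(S_p)=\mathcal{LF}(S)\subsetneq\mathcal{LF}(S')$ or $\mathcal{B}(S_p)=\mathcal{LF}(S')\subsetneq\mathcal{LF}(S)$; (iii) $\mathcal{LF}(S)\not\subset\mathcal{LF}(S')$ and $\mathcal{LF}(S')\not\subset\mathcal{LF}(S)$.
   Context: Canonical (standard) Local Friendliness (LF) scenario: a quadruple $S=(I_A,I_F,M,O)$, also written $S=(S_p,I_F)$ with $S_p=(I_A,M,O)$ the public scenario, where $I_A=\{1,\dots,N\}$ is a finite set of parties (superobservers), $I_F\subset I_A$ (possibly empty, possibly all of $I_A$) is the set of parties having a ''friend'', $M=M_1\times\dots\times M_N$ with $M_i=\{1,\dots,m_i\}$ the finite set of measurement settings of party $i$, and for each $i$ and $x_i\in M_i$ there is a finite outcome set $O_{x_i}$ (depending on $i$ and on the setting $x_i$); for $\vec x\in M$ put $O_{\vec x}=O_{x_1}\times\dots\times O_{x_N}$, and $O=\{O_{\vec x}\}_{\vec x\in M}$. The sets $I_A$, $M_i$, $O_{x_i}$ all have cardinality at least 2. The symbol $\subset$ denotes non-strict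 inclusion and $\subsetneq$ strict inclusion. For $J\subset I_A$, $\vec a_J$ and $\vec x_J$ denote the substrings indexed by $J$. Behaviour: a family $\wp=(\wp(\cdot|\vec x))_{\vec x\in M}$ where $\wp(\cdot|\vec x)$ is a probability distribution on $O_{\vec x}$. $\mathcal{B}(S)=\mathcal{B}(S_p)$: the set of behaviours admitting a local hidden variable (LHV) model, i.e. $\wp(\vec a|\vec x)=\int_\Lambda d\lambda\,p(\lambda)\prod_{i=1}^N P(a_i|x_i,\lambda)$ for all $\vec a,\vec x$, for some probability space $(\Lambda,p)$ and, for each $i$, $x_i$, $\lambda$, a probability distribution $P(\cdot|x_i,\lambda)$ on $O_{x_i}$. It does not depend on $I_F$. $\mathcal{LF}(S)$: the set of behaviours $\wp$ for which there exist a probability distribution $P(\vec c)$ on strings $\vec c=(c_i)_{i\in I_F}\in\prod_{i\in I_F}O_{x_i=1}$ (here $O_{x_i=1}$ is the outcome set of party $i$'s setting $1$) and, for each $\vec c$ and $\vec x\in M$, a probability distribution $P(\cdot|\vec x,\vec c)$ on $O_{\vec x}$, such that: (1) $\wp(\vec a|\vec x)=\sum_{\vec c}P(\vec a|\vec x,\vec c)P(\vec c)$; (2) (Local Agency) for every $V\subset I_A$ the marginal $P(\vec a_V|\vec x,\vec c)$ depends on $\vec x$ only through $\vec x_V$; (3) with $F_{\vec x}=\{i\in I_F: x_i=1\}$, $P(\vec a_{F_{\vec x}}|\vec x,\vec c)=\prod_{i\in F_{\vec x}}\delta_{a_i,c_i}$. Equivalently $\wp(\vec a|\vec x)=\sum_{\vec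 c}\prod_{i\in F_{\vec x}}\delta_{a_i,c_i}\,P(\vec a_{J_{\vec x}}|\vec x_{J_{\vec x}},\vec c)\,P(\vec c)$ with $J_{\vec x}=I_A\setminus F_{\vec x}$, the $P(\cdot|\cdot,\vec c)$ satisfying Local Agency. If $I_F=\emptyset$, $\vec c$ is the empty string. *)

(* Defs.v *)
From HB Require Import structures.
From mathcomp Require Import all_boot all_order all_algebra.
From mathcomp Require Import all_classical all_reals all_analysis.
Set Implicit Arguments.
Unset Strict Implicit.
Unset Printing Implicit Defensive.
Import Order.TTheory GRing.Theory Num.Theory.
Local Open Scope classical_set_scope.
Local Open Scope ring_scope.

Record public_scenario := PublicScenario {
  nparties : nat;
  nsettings : 'I_nparties -> nat;
  outcome : forall i : 'I_nparties, 'I_(nsettings i) -> finType;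
  nparties_ge2 : (2 <= nparties)%N;
  nsettings_ge2 : forall i, (2 <= nsettings i)%N;
  outcome_ge2 : forall i (y : 'I_(nsettings i)), (2 <= #|outcome y|)%N }.

Notation party S := 'I_(nparties S).
Notation setting i := 'I_(nsettings i).
Notation party_in V := {i | i \in V}.

(* Settings are numbered from 0, so the distinguished setting 1 of a party is
   the ordinal 0. *)
Definition setting1 (S : public_scenario) (i : party S) : setting i :=
  Ordinal (ltnW (nsettings_ge2 i)).

(* Strings of settings are plain dependent functions, so that the outcome types
   attached to a string [x] and to its substring [sub_settings V x] agree by
   conversion. *)
Definition settings (S : public_scenario) := forall i : party S, setting i.

Definition outcomes (S : public_scenario) (x : settings S) :=
  {dffun forall i : party S, outcome (x i)}.

Definition settings_in (S : public_scenario) (V : {set party S}) :=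
  forall i : party_in V, setting (val i).

Definition outcomes_in (S : public_scenario) (V : {set party S})
    (xV : settings_in V) :=
  {dffun forall i : party_in V, outcome (xV i)}.

Definition sub_settings (S : public_scenario) (V : {set party S})
    (x : settings S) : settings_in V :=
  fun i => x (val i).
Arguments sub_settings {S} V x i.

Definition sub_outcomes (S : public_scenario) (V : {set party S})
    (x : settings S) (a : outcomes x) : outcomes_in (sub_settings V x) :=
  [ffun i : party_in V => a (val i) : outcome (sub_settings V x i)].
Arguments sub_outcomes {S} V {x} a.

Definition is_distribution (R : realType) (T : finType) (f : T -> R) : Prop :=
  (forall t, 0 <= f t) /\ \sum_t f t = 1.

Definition cond_probs (R : realType) (S : public_scenario) :=
  forall x : settings S, outcomes x -> R.

Definition behaviour (R : realType) (S : public_scenario) (w : cond_probs R S) :=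
  forall x : settings S, is_distribution (w x).

Definition marginal (R : realType) (S : public_scenario) (w : cond_probs R S)
    (V : {set party S}) (x : settings S)
    (aV : outcomes_in (sub_settings V x)) : R :=
  \sum_(a : outcomes x | sub_outcomes V a == aV) w x a.

Definition local_agency (R : realType) (S : public_scenario)
    (w : cond_probs R S) : Prop :=
  forall V : {set party S},
    exists Q : forall xV : settings_in V, outcomes_in xV -> R,
      forall (x : settings S) (aV : outcomes_in (sub_settings V x)),
        marginal w aV = Q (sub_settings V x) aV.

Definition lhv (R : realType) (S : public_scenario) : set (cond_probs R S) :=
  [set w | behaviour w /\
    exists (d : measure_display) (L : measurableType d) (p : probability L R)
           (P : forall (i : party S) (y : setting i), L -> outcome y -> R),
      [/\ forall (i : party S) (y : setting i) (b : outcome y),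
            measurable_fun setT (fun l => P i y l b),
          forall (i : party S) (y : setting i) (l : L),
            is_distribution (P i y l)
        & forall (x : settings S) (a : outcomes x),
            (w x a)%:E = (\int[p]_l (\prod_i P i (x i) l (a i))%:E)%E]].
Arguments lhv R S : clear implicits.

Definition friend_outcomes (S : public_scenario) (IF : {set party S}) :=
  {dffun forall i : party_in IF, outcome (setting1 (val i))}.

Definition asked (S : public_scenario) (IF : {set party S})
    (x : settings S) : {set party S} :=
  [set i in IF | x i == setting1 i].

Lemma asked_sub (S : public_scenario) (IF : {set party S}) (x : settings S)
  (i : party S) : i \in asked IF x -> i \in IF.
Proof. by rewrite inE => /andP[]. Qed.

Definition asked_friend (S : public_scenario) (IF : {set party S})
    (x : settings S) (i : party_in (asked IF x)) : party_in IF :=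
  exist _ (val i) (asked_sub (valP i)).

(* The Kronecker delta between a_i, of type [outcome (x i)], and c_i, of type
   [outcome (setting1 i)], compares the setting-tagged outcomes; as [i] is
   in [asked IF x] the tags are equal and this is the equality a_i = c_i. *)
Definition reports_friends (R : realType) (S : public_scenario)
    (IF : {set party S}) (w : cond_probs R S) (c : friend_outcomes IF) : Prop :=
  forall (x : settings S)
         (aF : outcomes_in (sub_settings (asked IF x) x)),
    marginal w aF =
    \prod_(i : party_in (asked IF x))
      (Tagged (@outcome S (val i)) (aF i) ==
       Tagged (@outcome S (val i)) (c (asked_friend i)))%:R.

Definition LF (R : realType) (S : public_scenario) (IF : {set party S})
    : set (cond_probs R S) :=
  [set w | behaviour w /\
    exists (Pc : friend_outcomes IF -> R)
           (P : friend_outcomes IF -> cond_probs R S),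
      [/\ is_distribution Pc,
          forall c, behaviour (P c),
          forall (x : settings S) (a : outcomes x),
            w x a = \sum_(c : friend_outcomes IF) P c x a * Pc c,
          forall c, local_agency (P c)
        & forall c, reports_friends (P c) c]].
Arguments LF R {S} IF.

Definition exactly_one3 (A B C : Prop) : Prop :=
  [\/ [/\ A, ~ B & ~ C], [/\ ~ A, B & ~ C] | [/\ ~ A, ~ B & C]].

(* Main.v *)
(* For j in IF' but not in IF and l <> j, let j (settings 1 and u1) and l (two
   settings at which, if l is in IF, the friend's outcome is not revealed) share
   a PR box.  This behaviour is in LF IF.  It is not in LF IF': there, given the
   friends' outcomes, the outcome of j at setting 1 is fixed, hence by the
   perfect correlations and Local Agency so are the outcomes of l at both
   settings, which contradicts the correlations at u1.  So if LF IF is included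
   in LF IF', no such l exists: IF contains all parties but j, each with
   two settings.  Given the friends' outcomes and the outcomes at the
   second settings, only j still has a choice of setting, and conditioning on
   those outcomes gives an LHV model; hence LF IF is the LHV set.  If the
   inclusion is an equality, the same applies with the roles exchanged. *)
Require Import Defs.
From HB Require Import structures.
From mathcomp Require Import all_boot all_order all_algebra.
From mathcomp Require Import all_classical all_reals all_analysis.
From mathcomp Require Import measurable_realfun.
Set Implicit Arguments.
Unset Strict Implicit.
Unset Printing Implicit Defensive.
Import Order.TTheory GRing.Theory Num.Theory.
Local Open Scope classical_set_scope.
Local Open Scope ring_scope.

(** * Finite distributions *)

Lemma sum_prod_dffun (R : comPzSemiRingType) (I : finType) (T : I -> finType)
    (F : forall i, T i -> R) :
  \sum_(g : {dffun forall i, T i}) \prod_i F i (g i) = \prod_i \sum_t F i t.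
Proof.
rewrite (reindex (@dffun_of_fprod I T)); last exact/onW_bij/dffun_of_fprod_bij.
(* The distributive law [big_fprod] takes its factors as finite functions, hence this repackaging of
   [F]. *)
pose P i := [ffun t : T i => F i t].
transitivity (\sum_(t : fprod T) \prod_(i in I) P i (t i)).
  by apply: eq_bigr => t _; apply: eq_bigr => i _; rewrite !ffunE.
rewrite big_fprod.
rewrite -(bigA_distr_big_dep (fun i => tagged_with T i)
  (fun i => untag 0 (P i))).
apply: eq_bigr => i _; rewrite -(@big_tag _ _ _ I T (fun i => P i) i).
by apply: eq_bigr => t _; rewrite ffunE.
Qed.

Lemma sum_delta (R : pzSemiRingType) (T : finType) (F : T -> R) (t : T) :
  \sum_u F u * (t == u)%:R = F t.
Proof.
rewrite (bigD1 t)//= eqxx mulr1 big1 ?addr0// => u /negbTE ut.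
by rewrite eq_sym ut mulr0.
Qed.

Lemma sum_dirac (R : pzSemiRingType) (T : finType) (t : T) :
  \sum_u (t == u)%:R = 1 :> R.
Proof.
by rewrite -[RHS](sum_delta (fun=> 1) t); apply: eq_bigr => u _; rewrite mul1r.
Qed.

Lemma distribution_support (R : realType) (T : finType) (q : T -> R) :
  is_distribution q -> exists t, q t != 0.
Proof.
move=> dq; apply/existsP; apply: contra_eqT dq.2.
rewrite negb_exists => /forallP q0.
rewrite big1 ?(eq_sym 0) ?oner_neq0// => t _.
by apply/eqP; move: (q0 t); rewrite negbK.
Qed.

Lemma sumr_ge0_neq0 (R : realType) (T : finType) (P : pred T) (F : T -> R) t :
  (forall u, 0 <= F u) -> P t -> F t != 0 -> \sum_(u | P u) F u != 0.
Proof.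
move=> F0 Pt Ft; rewrite psumr_neq0//; apply/hasP; exists t.
  by rewrite mem_index_enum.
by rewrite Pt lt0r Ft F0.
Qed.

Section FinitelySupportedProbability.
Context (R : realType) (T : finType) (q : T -> R) (hq : is_distribution q).

(** The points of [T] are carried to [nat] by [enum_rank], so that a finite distribution lives on a
    standard measurable space. The default 0 never enters, since [msum] below stops at [#|T|]. *)
Let weight (k : nat) : {nonneg R} :=
  if insub k is Some i then NngNum (hq.1 (enum_val (i : 'I_#|T|)))
  else 0%:nng.

Definition fin_probability : set nat -> \bar R :=
  msum (fun k => mscale (weight k) (dirac k)) #|T|.

HB.instance Definition _ := Measure.on fin_probability.

Lemma integral_fin_probability (f : nat -> \bar R) : (forall k, (0 <= f k)%E) ->
  (\int[fin_probability]_k f k = \sum_t (q t)%:E * f (enum_rank t))%E.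
Proof.
move=> f0; rewrite ge0_integral_measure_sum//.
rewrite [RHS](reindex (@enum_val T T)) /=; last first.
  by exists enum_rank => t _; rewrite ?enum_valK ?enum_rankK.
apply: eq_bigr => i _; rewrite ge0_integral_mscale//.
by rewrite integral_dirac// diracT mul1e enum_valK /weight valK.
Qed.

Let fin_probabilityT : fin_probability setT = 1%E.
Proof.
rewrite -[LHS]mul1e -integral_cst//= integral_fin_probability//.
under eq_bigr do rewrite mule1.
by rewrite sumEFin hq.2.
Qed.

HB.instance Definition _ :=
  Measure_isProbability.Build _ _ _ fin_probability fin_probabilityT.

End FinitelySupportedProbability.

(** * Local hidden variable models as finite mixtures *)

Definition strategy (S : public_scenario) :=
  forall (i : party S) (y : setting i), outcome y.

Definition response (S : public_scenario) (g : strategy S) (x : settings S) :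
  outcomes x := [ffun i => g i (x i)].

(** Plain functions are convenient for building strategies pointwise; this finite type is the one
    over which sums are taken. *)
Definition fin_strategy (S : public_scenario) :=
  {dffun forall i : party S, {dffun forall y : setting i, outcome y}}.

Definition strategy_of (S : public_scenario) (g : fin_strategy S) :
  strategy S := fun i y => g i y.
Coercion strategy_of : fin_strategy >-> strategy.

Lemma eq_responseE (S : public_scenario) (g : strategy S) (x : settings S)
  (a : outcomes x) : (a == response g x) = [forall i, a i == g i (x i)].
Proof.
apply/eqP/forallP => [-> i|ag]; first by rewrite ffunE.
by apply/ffunP => i; rewrite ffunE; apply/eqP.
Qed.

Section Fine.
Context (R : realType) (S : public_scenario).

Section Product.
Context (P : forall (i : party S) (y : setting i), outcome y -> R).
Hypothesis P1 : forall (i : party S) (y : setting i),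
  \sum_(o : outcome y) P o = 1.

Lemma sum_prod_strategies :
  \sum_(g : fin_strategy S) \prod_i \prod_y P (g i y) = 1.
Proof.
rewrite (sum_prod_dffun
  (fun i (h : {dffun forall y : setting i, outcome y}) => \prod_y P (h y))).
by apply: big1 => i _; rewrite sum_prod_dffun big1.
Qed.

(** Under the product weight all answers are drawn independently. The answers to settings not
    occurring in [x] sum out to 1, and each [x i] contributes the factor [P (a i)]. *)
Lemma sum_prod_strategies_response (x : settings S) (a : outcomes x) :
  \sum_(g : fin_strategy S)
     (\prod_i \prod_y P (g i y)) * (a == response g x)%:R =
  \prod_i P (a i).
Proof.
transitivity (\sum_(g : fin_strategy S)
    \prod_i ((\prod_y P (g i y)) * (a i == g i (x i))%:R)).
  apply: eq_bigr => g _; rewrite big_split/=; congr (_ * _).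
  rewrite eq_responseE; case: forallP => [ag|/existsNP[i /negP aNg]].
    by rewrite big1// => i _; rewrite ag.
  by rewrite (bigD1 i)//= (negbTE aNg) mul0r.
rewrite (sum_prod_dffun (fun i (h : {dffun forall y : setting i, outcome y}) =>
  (\prod_y P (h y)) * (a i == h (x i))%:R)).
apply: eq_bigr => i _.
(* The constraint at [x i] is absorbed into the factor of the setting [x i]; tags are compared
   because [y = x i] does not hold by conversion. *)
pose G (y : setting i) (o : outcome y) : R :=
  P o * (if y == x i
         then (Tagged (@outcome S i) (a i) == Tagged (@outcome S i) o)%:R
         else 1).
transitivity (\sum_(h : {dffun forall y : setting i, outcome y})
    \prod_y G y (h y)).
  apply: eq_bigr => h _; rewrite big_split/=; congr (_ * _).
  rewrite (bigD1 (x i))//= eqxx eq_Tagged/= big1 ?mulr1//.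
  by move=> y /negbTE yx; rewrite yx.
rewrite sum_prod_dffun (bigD1 (x i))//= [X in _ * X]big1 ?mulr1; last first.
  by move=> y /negbTE yx; rewrite /G yx; under eq_bigr do rewrite mulr1.
rewrite /G eqxx; under eq_bigr do rewrite eq_Tagged/=.
exact: sum_delta.
Qed.

End Product.

(** Fine's argument: drawing in advance each party's answer to every setting moves the local
    randomness into the hidden variable. A deterministic strategy then gets as weight the integral
    of the product of its response probabilities. *)
Lemma lhv_fin_mixture (w : cond_probs R S) : lhv R S w ->
  exists q : fin_strategy S -> R, is_distribution q /\
    forall x (a : outcomes x),
      w x a = \sum_(g : fin_strategy S) q g * (a == response g x)%:R.
Proof.
move=> [_ [d [L [p [P [mP dP wE]]]]]].
pose Q (g : fin_strategy S) l : R := \prod_i \prod_y P i y l (g i y).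
have mQ g : measurable_fun setT (Q g).
  apply: measurable_prod => i _.
  by apply: measurable_prod => y _; exact: mP.
have Q0 g l : 0 <= Q g l.
  by apply: prodr_ge0 => i _; apply: prodr_ge0 => y _; case: (dP i y l).
pose q g : \bar R := (\int[p]_l (Q g l)%:E)%E.
have q0 g : (0 <= q g)%E by apply: integral_ge0 => l _; rewrite lee_fin.
have q1 : (\sum_g q g = 1)%E.
  rewrite /q -ge0_integral_sum//; last 2 first.
  - by move=> g; apply/measurable_EFinP; exact: mQ.
  - by move=> g l _; rewrite lee_fin.
  rewrite -[RHS](probability_setT p) -[RHS]mul1e -integral_cst//.
  apply: eq_integral => l _; rewrite sumEFin/=.
  by rewrite (sum_prod_strategies (fun i y => (dP i y l).2)).
(* Each weight is at most the total 1, hence finite. *)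
have qfin g : (fine (q g))%:E = q g.
  rewrite fineK// ge0_fin_numE// (@le_lt_trans _ _ 1%E) ?ltry//.
  by rewrite -q1 (bigD1 g)//= leeDl// sume_ge0.
exists (fun g => fine (q g)); split.
  split=> [g|]; first exact: fine_ge0.
  by apply: EFin_inj; rewrite -sumEFin -q1; apply: eq_bigr => g _; exact: qfin.
move=> x a; apply: EFin_inj; rewrite wE -sumEFin.
transitivity (\sum_(g : fin_strategy S)
    \int[p]_l ((Q g l)%:E * (a == response g x)%:R%:E))%E; last first.
  apply: eq_bigr => g _; rewrite EFinM qfin ge0_integralZr//.
  - by apply/measurable_EFinP; exact: mQ.
  - by move=> l _; rewrite lee_fin.
rewrite -ge0_integral_sum//; last 2 first.
- move=> g; apply: emeasurable_funM; last exact: measurable_cst.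
  by apply/measurable_EFinP; exact: mQ.
- by move=> g l _; rewrite -EFinM lee_fin mulr_ge0.
apply: eq_integral => l _.
under [RHS]eq_bigr do rewrite -EFinM.
rewrite sumEFin (sum_prod_strategies_response (fun i y => (dP i y l).2)).
by [].
Qed.

Lemma fin_product_lhv (T : finType) (q : T -> R)
    (P : forall (i : party S) (y : setting i), T -> outcome y -> R)
    (w : cond_probs R S) :
  behaviour w -> is_distribution q ->
  (forall (i : party S) (y : setting i) t, is_distribution (P i y t)) ->
  (forall x (a : outcomes x), w x a = \sum_t q t * \prod_i P i (x i) t (a i)) ->
  lhv R S w.
Proof.
move=> bw dq dP wE; split => //.
have [t0 _] := distribution_support dq.
(* Decodes the hidden variable; the value [t0] beyond the enumeration keeps the responses
   distributions everywhere and carries no mass. *)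
pose f (k : nat) := nth t0 (enum T) k.
have fK t : f (enum_rank t) = t by exact: nth_enum_rank.
exists _, nat, (fin_probability dq), (fun i y k => P i y (f k)); split => //.
move=> x a; rewrite integral_fin_probability; last first.
  by move=> k; rewrite lee_fin prodr_ge0// => i _; case: (dP i (x i) (f k)).
by rewrite wE -sumEFin; apply: eq_bigr => t _; rewrite fK EFinM.
Qed.

End Fine.

(** * Local agency and friends' reports *)

Section LocalAgency.
Context (R : realType) (S : public_scenario).
Implicit Types (w : cond_probs R S) (V : {set party S}) (x : settings S)
  (g : strategy S).

Lemma outcome_inh (i : party S) (y : setting i) : exists o : outcome y, true.
Proof.
have /card_gt0P[b _] : (0 < #|outcome y|)%N by rewrite ltnW// outcome_ge2.
by exists b.
Qed.

Lemma extend_settings V (xV : settings_in V) : exists x, sub_settings V x = xV.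
Proof.
have H (i : party S) : exists y : setting i, forall h : (i \in V),
    y = xV (exist _ i h).
  have [h|h] := pselect (i \in V); last by exists (setting1 i).
  by exists (xV (exist _ i h)) => h'; rewrite (bool_irrelevance h h').
exists (fun i => projT1 (cid (H i))).
apply: functional_extensionality_dep => -[i h] /=.
by rewrite /sub_settings; case: (cid _) => /=.
Qed.

Lemma extend_outcomes V (xV : settings_in V) (aV : outcomes_in xV) :
  exists g, forall k : party_in V, g (val k) (xV k) = aV k.
Proof.
(* Comparing tagged outcomes lets [y] range over all settings of [i], although a value is prescribed
   at a single one. *)
have H (i : party S) (y : setting i) : exists o : outcome y,
    forall h : (i \in V), y = xV (exist _ i h) ->
    Tagged (@outcome S i) o = Tagged (@outcome S i) (aV (exist _ i h)).
  have [b _] := outcome_inh y.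
  have [h|h] := pselect (i \in V); last by exists b.
  have [->|/eqP yx] := eqVneq y (xV (exist _ i h)).
    by exists (aV (exist _ i h)) => h' _; rewrite (bool_irrelevance h h').
  by exists b => h'; rewrite (bool_irrelevance h' h) => /yx.
exists (fun i y => projT1 (cid (H i y))) => -[i h] /=.
by case: (cid _) => o /= /(_ h erefl)/eqP; rewrite eq_Tagged => /eqP.
Qed.

Lemma response_onto x (a : outcomes x) : exists g, a = response g x.
Proof.
have [g gE] := extend_outcomes (sub_outcomes [set: party S]%SET a).
exists g; apply/ffunP => i; rewrite ffunE.
by have /= := gE (exist _ i (finset.in_setT i)); rewrite ffunE/= => <-.
Qed.

(** The outcome substring is given through a strategy, so that it makes sense at every [x]:
    marginals at two setting strings can then be compared without casts. *)
Definition response_marginal w V g x : R :=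
  \sum_(a : outcomes x | [forall (i | i \in V), a i == g i (x i)]) w x a.

Definition response_in V g (xV : settings_in V) : outcomes_in xV :=
  [ffun k => g (val k) (xV k)].

Lemma marginal_response w V g x :
  marginal w (response_in g (sub_settings V x)) = response_marginal w V g x.
Proof.
apply: eq_bigl => a; apply/eqP/forall_inP => [/ffunP aE i iV|aE].
  by have := aE (exist _ i iV); rewrite !ffunE/= => ->.
by apply/ffunP => -[i iV]; rewrite !ffunE; apply/eqP/aE.
Qed.

Definition no_signalling w := forall V g x x',
  (forall i, i \in V -> x i = x' i) ->
  response_marginal w V g x = response_marginal w V g x'.

(** For the converse, [Q] is the marginal at chosen extensions of the two substrings; no-signalling
    makes the choice of settings outside [V] immaterial. *)
Lemma local_agencyP w : local_agency w <-> no_signalling w.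
Proof.
split=> [la V g x x' xx'|ns V].
  have [Q QE] := la V; rewrite -!marginal_response !QE.
  suff -> : sub_settings V x = sub_settings V x' by [].
  by apply: functional_extensionality_dep => -[i iV]; exact: xx'.
exists (fun xV aV => response_marginal w V (projT1 (cid (extend_outcomes aV)))
  (projT1 (cid (extend_settings xV)))) => x aV.
case: (cid _) => g gE /=; case: (cid _) => x' x'E /=.
have -> : aV = response_in g (sub_settings V x).
  by apply/ffunP => k; rewrite ffunE gE.
rewrite marginal_response; apply: ns => i iV.
by have := f_equal (fun u => u (exist _ i iV)) x'E.
Qed.

(** The marginal of [i] alone is the same at [x] and [x'], so a value of positive probability at [x]
    still occurs at [x']. *)
Lemma no_signalling_support w (i : party S) x x' (a : outcomes x) g :
  behaviour w -> no_signalling w -> x i = x' i ->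
  w x a != 0 -> a i = g i (x i) ->
  exists2 a' : outcomes x', w x' a' != 0 & a' i = g i (x' i).
Proof.
move=> bw ns xx' wa ag.
have : response_marginal w [set i]%SET g x' != 0.
  rewrite -(ns _ _ x) => [|k /finset.set1P->//].
  apply: (@sumr_ge0_neq0 _ _ _ _ a) => //; first by case: (bw x).
  by apply/forall_inP => k /finset.set1P->; rewrite ag.
rewrite psumr_neq0 => [|a' _]; last by case: (bw x').
move=> /hasP[a' _ /andP[/forall_inP a'g /lt0r_neq0 wa']].
by exists a' => //; apply/eqP/a'g/finset.set11.
Qed.

End LocalAgency.

Section Friends.
Context (R : realType) (S : public_scenario) (IF : {set party S}).
Implicit Types (w : cond_probs R S) (x : settings S) (g : strategy S)
  (c : friend_outcomes IF).

Definition friend_report g : friend_outcomes IF :=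
  [ffun k => g (val k) (setting1 (val k))].

Lemma friend_report_onto c : exists g, friend_report g = c.
Proof.
have [g gE] := @extend_outcomes S IF (fun k => setting1 (val k)) c.
by exists g; apply/ffunP => k; rewrite ffunE gE.
Qed.

Lemma friend_report_section : exists G : friend_outcomes IF -> strategy S,
  forall c, friend_report (G c) = c.
Proof.
by exists (fun c => projT1 (cid (friend_report_onto c))) => c; case: (cid _).
Qed.

Lemma asked_setting x (i : party S) : i \in asked IF x -> x i = setting1 i.
Proof. by rewrite inE => /andP[_ /eqP]. Qed.

Lemma reports_friends_support w g x (a : outcomes x) (i : party S) :
  behaviour w -> reports_friends w (friend_report g) ->
  w x a != 0 -> i \in asked IF x -> a i = g i (x i).
Proof.
move=> bw rf wa ia.
have : marginal w (sub_outcomes (asked IF x) a) != 0.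
  by apply: (@sumr_ge0_neq0 _ _ _ _ a) => //; case: (bw x).
rewrite rf => /prodf_neq0 /(_ (exist _ i ia) isT).
rewrite pnatr_eq0 eqb0 negbK !ffunE/=.
by rewrite -(asked_setting ia) eq_Tagged/= => /eqP.
Qed.

(** The product of deltas is 0 or 1, so the condition on marginals only constrains the support: the
    total mass 1 sits on outcomes agreeing with [g] on the asked friends. *)
Lemma support_reports_friends w g : behaviour w ->
  (forall x (a : outcomes x) (i : party S),
     w x a != 0 -> i \in asked IF x -> a i = g i (x i)) ->
  reports_friends w (friend_report g).
Proof.
move=> bw sw x aF.
have tagE (k : party_in (asked IF x)) :
    (Tagged (@outcome S (val k)) (aF k) ==
     Tagged (@outcome S (val k)) (friend_report g (asked_friend k))) =
    (aF k == g (val k) (x (val k))).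
  rewrite ffunE /asked_friend/=.
  by rewrite -(asked_setting (valP k)) eq_Tagged.
under eq_bigr do rewrite tagE.
have [/forallP aFg|] := boolP [forall k, aF k == g (val k) (x (val k))].
  rewrite big1 => [|k _]; last by rewrite aFg.
  rewrite /marginal big_mkcond -[RHS](bw x).2; apply: eq_bigr => a _.
  case: ifPn => //; have [//|wa] := eqVneq (w x a) 0.
  case/eqP; apply/ffunP => k; rewrite ffunE (eqP (aFg k)).
  exact: sw (valP k).
rewrite negb_forall => /existsP[k kN].
rewrite [RHS](bigD1 k)//= (negbTE kN) mul0r /marginal big1// => a /eqP aE.
apply: contraNeq kN => wa; rewrite -aE ffunE; apply/eqP.
exact: sw (valP k).
Qed.

End Friends.

(** * Mixtures of strategies *)

Section Mixture.
Context (R : realType) (S : public_scenario) (T : finType).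
Context (q : T -> R) (D : T -> settings S -> strategy S).
Arguments D : clear implicits.
Hypothesis dq : is_distribution q.

Definition mixture : cond_probs R S :=
  fun x a => \sum_t q t * (a == response (D t x) x)%:R.

Lemma sum_mixture x (A : pred (outcomes x)) :
  \sum_(a | A a) mixture a = \sum_t q t * (A (response (D t x) x))%:R.
Proof.
rewrite exchange_big/=; apply: eq_bigr => t _.
rewrite -big_distrr/=; congr (_ * _).
have [Ar|Ar] := boolP (A _).
  by rewrite (bigD1 _ Ar)/= eqxx big1 ?addr0// => a /andP[_ /negbTE ->].
by rewrite big1// => a Aa; case: eqP Ar => // <-; rewrite Aa.
Qed.

Lemma behaviour_mixture : behaviour mixture.
Proof.
move=> x; split=> [a|].
  by apply: sumr_ge0 => t _; rewrite mulr_ge0// dq.1.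
by rewrite sum_mixture -[RHS]dq.2; apply: eq_bigr => t _; rewrite mulr1.
Qed.

Lemma mixture_support x (a : outcomes x) : mixture a != 0 ->
  exists2 t, q t != 0 & a = response (D t x) x.
Proof.
move=> ma; suff [t /andP[qt /eqP aE]] :
  exists t, (q t != 0) && (a == response (D t x) x) by exists t.
apply/existsP; apply: contraNT ma; rewrite negb_exists => /forallP N.
rewrite /mixture big1// => t _; move: (N t); rewrite negb_and negbK.
by case/orP => [/eqP ->|/negbTE ->]; rewrite ?mul0r ?mulr0.
Qed.

(* Relabelling the hidden variable may depend on the settings, so that a
   mixture whose strategies look at remote settings can still be
   non-signalling. *)
Lemma no_signalling_mixture :
  (forall (V : {set party S}) (x x' : settings S),
    (forall i, i \in V -> x i = x' i) ->
    exists s : T -> T, [/\ injective s, forall t, q (s t) = q t &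
      forall t i, i \in V -> D t x i (x i) = D (s t) x' i (x i)]) ->
  no_signalling mixture.
Proof.
move=> H V g x x' xx'; have [s [sI qs Ds]] := H V x x' xx'.
rewrite /response_marginal !sum_mixture [RHS](reindex_inj sI)/=.
apply: eq_bigr => t _; rewrite qs; congr (_ * (nat_of_bool _)%:R).
apply: eq_forallb_in => i iV; rewrite !ffunE (Ds t i iV).
by rewrite (xx' i iV).
Qed.

End Mixture.

(** * LHV behaviours satisfy Local Friendliness *)

Section LhvLF.
Context (R : realType) (S : public_scenario) (IF : {set party S}).

Lemma friend_report_asked (g g' : strategy S) x (i : party S) :
  friend_report IF g = friend_report IF g' -> i \in asked IF x ->
  g i (x i) = g' i (x i).
Proof.
move=> /ffunP gg' ia; have := gg' (exist _ i (asked_sub ia)).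
by rewrite !ffunE/= (asked_setting ia).
Qed.

Lemma mixture_reports (T : finType) (q : T -> R)
    (D : T -> settings S -> strategy S) (g : strategy S) :
  is_distribution q ->
  (forall t x (i : party S), q t != 0 -> i \in asked IF x ->
     D t x i (x i) = g i (x i)) ->
  reports_friends (mixture q D) (friend_report IF g).
Proof.
move=> dq H; apply: support_reports_friends; first exact: behaviour_mixture.
by move=> x a i /mixture_support[t qt ->] ia; rewrite ffunE H.
Qed.

(** In a mixture of deterministic strategies the friends' outcomes can be read off as the answers to
    setting 1; conditioning the weights on them gives the required model. *)
Lemma lhv_LF : lhv R S `<=` LF R IF.
Proof.
move=> w lw; split; first by case: lw.
have [q [dq wE]] := lhv_fin_mixture lw.
have fin_onto (c : friend_outcomes IF) :
    exists g : fin_strategy S, friend_report IF g = c.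
  have [g <-] := friend_report_onto c.
  exists ([ffun i => [ffun y => g i y]] : fin_strategy S).
  by apply/ffunP => k; rewrite !ffunE /strategy_of !ffunE.
pose G c := projT1 (cid (fin_onto c)).
have GE c : friend_report IF (G c) = c by rewrite /G; case: (cid _).
pose Pc (c : friend_outcomes IF) :=
  \sum_(g : fin_strategy S | friend_report IF g == c) q g.
(* When [c] has probability 0, a point mass on some strategy reporting [c] is used, since the
   conditions on the model are imposed for every [c]. *)
pose qc (c : friend_outcomes IF) (g : fin_strategy S) :=
  if Pc c == 0 then (G c == g)%:R
  else q g / Pc c * (friend_report IF g == c)%:R.
have q0 g : 0 <= q g by exact: dq.1.
have Pc0 c : 0 <= Pc c by exact: sumr_ge0.
have qcE c g : qc c g * Pc c = q g * (friend_report IF g == c)%:R.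
  rewrite /qc; case: eqVneq => [Pc00|Pcn0]; last by rewrite mulrAC divfK.
  rewrite Pc00 mulr0; case: eqVneq => [gc|]; last by rewrite mulr0.
  by rewrite mulr1 (psumr_eq0P _ Pc00)//= gc.
have dqc c : is_distribution (qc c).
  split=> [g|].
    by rewrite /qc; case: ifP => // _; rewrite mulr_ge0// divr_ge0.
  rewrite /qc; case: eqVneq => [_|Pcn0]; first exact: sum_dirac.
  under eq_bigr do rewrite mulrAC.
  rewrite -big_distrl/= -[RHS](divff Pcn0); congr (_ / _).
  rewrite /Pc [RHS]big_mkcond; apply: eq_bigr => g _.
  by case: eqP; rewrite ?mulr1 ?mulr0.
have qcG c g : qc c g != 0 -> friend_report IF g = c.
  rewrite /qc; case: ifP => _; rewrite ?mulf_eq0 pnatr_eq0 eqb0.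
    by rewrite negbK => /eqP <-.
  by rewrite negb_or negbK => /andP[_ /eqP].
exists Pc, (fun c => mixture (qc c) (fun (g : fin_strategy S) _ => g)); split.
- split=> //; rewrite -[RHS]dq.2 (exchange_big_dep predT)//=.
  apply: eq_bigr => g _.
  by rewrite (big_pred1 (friend_report IF (g : fin_strategy S))) => [//|c] /=.
- by move=> c; exact: behaviour_mixture.
- move=> x a; rewrite wE; under [RHS]eq_bigr do rewrite big_distrl/=.
  rewrite exchange_big/=; apply: eq_bigr => g _.
  under eq_bigr do rewrite mulrAC qcE mulrAC.
  exact/esym/sum_delta.
- move=> c; apply/local_agencyP/no_signalling_mixture => V x x' _.
  by exists id; split=> //; exact: inj_id.
- move=> c; rewrite -[X in reports_friends _ X]GE; apply: mixture_reports => //.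
  move=> g x i /qcG gc; apply: friend_report_asked.
  by rewrite GE.
Qed.

End LhvLF.

(** * PR boxes *)

Section Update.
Context (S : public_scenario).

Definition update (x : settings S) (i : party S) (y : setting i) : settings S :=
  fun k => match pselect (i = k) with
           | left e => eq_rect i (fun k => setting k) y k e
           | right _ => x k
           end.

Lemma update_eq x (i : party S) (y : setting i) : update x y i = y.
Proof.
by rewrite /update; case: pselect => // e; rewrite (eq_irrelevance e erefl).
Qed.

Lemma update_neq x (i k : party S) (y : setting i) :
  k != i -> update x y k = x k.
Proof.
by rewrite /update; case: pselect => // e /eqP; case; rewrite e.
Qed.

Lemma two_outcomes :
  exists e : forall (i : party S) (y : setting i), bool -> outcome y,
  forall (i : party S) (y : setting i), injective (e i y).
Proof.
have H (i : party S) (y : setting i) :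
    exists e : bool -> outcome y, injective e.
  have /card_gt1P[b0 [b1 [_ _ b01]]] := outcome_ge2 y.
  exists (fun b : bool => if b then b0 else b1) => -[] [] // /eqP.
    by rewrite (negbTE b01).
  by rewrite eq_sym (negbTE b01).
by exists (fun i y => projT1 (cid (H i y))) => i y; case: (cid _).
Qed.

End Update.

Section PRBox.
Context (R : realType) (S : public_scenario).
Context (e : forall (i : party S) (y : setting i), bool -> outcome y).
Arguments e : clear implicits.
Hypothesis eI : forall (i : party S) (y : setting i), injective (e i y).
Context (j l : party S) (lj : l != j) (u1 : setting j) (y0 y1 : setting l).
Hypotheses (u1_neq : u1 != setting1 j) (y01 : y0 != y1).

Definition flip (x : settings S) : bool := (x j == u1) && (x l == y1).

(** With [s] a fair coin this is a PR box between [j] and [l], all other answers following [g]. The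
    strategy itself signals through [flip x]; only the mixture over [s] does not. Settings are
    compared as numbers because [y] belongs to [i], not to [l]. *)
Definition pr_strategy (g : strategy S) (s : bool) (x : settings S) :
  strategy S := fun i y =>
  if i == j then e i y s
  else if (i == l) && (((y : nat) == y0) || ((y : nat) == y1))
  then e i y (s (+) flip x) else g i y.

Definition pr_box (g : strategy S) : cond_probs R S :=
  mixture (fun=> 2^-1) (pr_strategy g).

Lemma is_distribution_coin : is_distribution (fun _ : bool => 2^-1 : R).
Proof.
split=> [_|]; first by rewrite invr_ge0.
by rewrite big_bool/= -div1r -splitr.
Qed.

Lemma no_signalling_pr_box g : no_signalling (pr_box g).
Proof.
apply: no_signalling_mixture => V x x' xx'.
(* If [j] is in [V] the coin is visible and must be kept; [flip] is then unchanged whenever [l] is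
   in [V] too. Otherwise a change of [flip] is compensated by flipping the coin, which stays
   fair. *)
exists (fun s => if j \in V then s else s (+) (flip x (+) flip x')); split=> //.
  by move=> [] []; case: ifP => //; case: (flip x); case: (flip x').
move=> s i iV; rewrite /pr_strategy; case: eqP => [ij|_].
  by rewrite -ij iV.
case: eqP => //= il; case: ifP => // _; congr (e _ _ _).
case: ifP => jV; last by case: s; case: (flip x); case: (flip x').
by rewrite /flip (xx' j jV) (xx' l)// -il.
Qed.

(** No friend sees the coin: [j] has none, and if [l] has one, the box is used at settings other
    than 1. The friends' outcomes can therefore be deterministic, as given by [g]. *)
Lemma pr_box_LF (IF : {set party S}) g : j \notin IF ->
  (l \in IF -> (y0 != setting1 l) && (y1 != setting1 l)) ->
  LF R IF (pr_box g).
Proof.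
move=> jIF lIF; have dq := is_distribution_coin.
split; first exact: behaviour_mixture.
have [G GE] := friend_report_section IF.
pose c0 := friend_report IF g.
(* Only [c0] has positive weight; the other strings still need a model reporting them. At [c0] the
   strategy must be [g] itself, from which [G c0] may differ. *)
pose P c := if c == c0 then pr_box g else pr_box (G c).
exists (fun c => (c == c0)%:R), P; split.
- split=> //; rewrite (bigD1 c0)//= eqxx big1 ?addr0// => c /negbTE ->//.
- by move=> c; rewrite /P; case: ifP => _; exact: behaviour_mixture.
- move=> x a; rewrite (bigD1 c0)//= /P eqxx mulr1 big1 ?addr0//.
  by move=> c /negbTE ->; rewrite mulr0.
- move=> c; apply/local_agencyP; rewrite /P.
  by case: ifP => _; exact: no_signalling_pr_box.
- suff H h : reports_friends (pr_box h) (friend_report IF h).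
    by move=> c; rewrite /P; case: eqP => [->|_]; [exact: H|rewrite -{2}(GE c)].
  apply: mixture_reports => // s x i _ ia.
  have iIF := asked_sub ia; rewrite /pr_strategy.
  case: eqP => [ij|_]; first by rewrite ij (negbTE jIF) in iIF.
  case: eqP => //= il; rewrite (asked_setting ia).
  have /lIF/andP[] : l \in IF by rewrite -il.
  have -> : (setting1 i : nat) = setting1 l by rewrite il.
  by rewrite ![_ == setting1 l]eq_sym -!val_eqE/= => /negbTE -> /negbTE ->.
Qed.

Lemma pr_box_notin_LF (IF : {set party S}) g : j \in IF ->
  ~ LF R IF (pr_box g).
Proof.
move=> jIF [_ [Pc [P [dPc bP wE laP rfP]]]].
have [c Pcc] := distribution_support dPc.
have {laP} nsP := (local_agencyP (P c)).1 (laP c).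
have [G cE] := friend_report_onto c.
have {}rfP := rfP c; rewrite -{2}cE in rfP.
(* As [c] has positive weight, the support of [P c] lies in that of the box and inherits its perfect
   correlations. *)
have corr x (a : outcomes x) : (x l == y0) || (x l == y1) -> P c x a != 0 ->
    exists s, a j = e j (x j) s /\ a l = e l (x l) (s (+) flip x).
  move=> xl Pa; have : pr_box g a != 0.
    rewrite wE; apply: (@sumr_ge0_neq0 _ _ _ _ c) => //.
      by move=> c'; rewrite mulr_ge0// ?dPc.1//; case: (bP c' x).
    by rewrite mulf_neq0.
  move=> /mixture_support[s _ ->]; exists s; rewrite !ffunE /pr_strategy eqxx.
  by rewrite (negbTE lj) eqxx/= -!val_eqE/= in xl *; rewrite xl.
have supp x := distribution_support (bP c x).
pose x0 : settings S := update (@setting1 S) y0.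
have report x (a : outcomes x) : x j = setting1 j -> P c x a != 0 ->
    a j = G j (x j).
  move=> xj Pa; apply: (reports_friends_support _ rfP) => //.
  by rewrite inE jIF xj/=.
have flip1 x : x j = setting1 j -> flip x = false.
  by move=> xj; rewrite /flip xj eq_sym (negbTE u1_neq).
have x0j : x0 j = setting1 j by rewrite /x0 update_neq// eq_sym.
have x0l : x0 l = y0 by rewrite /x0 update_eq.
(* The bit [t] encodes the outcome seen by the friend of [j]. *)
have [t tE] : exists t, forall y, y = setting1 j -> G j y = e j y t.
  have [a Pa] := supp x0.
  have [|s [aj _]] := corr _ _ _ Pa; first by rewrite x0l eqxx.
  exists s => y ->; have := report _ _ x0j Pa; rewrite aj.
  by rewrite x0j.
have al_friend x (a : outcomes x) : (x l == y0) || (x l == y1) ->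
    x j = setting1 j -> P c x a != 0 -> a l = e l (x l) t.
  move=> xl xj Pa; have [s [aj ->]] := corr _ _ xl Pa.
  rewrite flip1// addbF; congr (e _ _ _); apply: (eI (y := x j)).
  by rewrite -aj report// tE.
(* Moving [j] to setting 1 does not change the distribution of the outcome of [l], which is
   therefore fixed by [t] at every setting of [j]. *)
have al x (a : outcomes x) : (x l == y0) || (x l == y1) ->
    P c x a != 0 -> a l = e l (x l) t.
  move=> xl Pa; have [s [_ al]] := corr _ _ xl Pa.
  pose x' := update x (setting1 j).
  have xx' : x l = x' l by rewrite /x' update_neq.
  have [a' Pa' a'l] := no_signalling_support
    (g := fun i y => e i y (s (+) flip x)) (bP c) nsP xx' Pa al.
  rewrite al; congr (e _ _ _); apply: (eI (y := x' l)).
  by rewrite -a'l (al_friend _ _ _ _ Pa') -?xx'// /x' update_eq.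
(* In both [x10] and [x11] party [j] has setting [u1], but [flip] is false in the first and true in
   the second, so the outcome of [j] would have to depend on the setting of [l]. *)
pose x10 : settings S := update x0 u1.
pose x11 : settings S := update x10 y1.
have x10l : x10 l = y0 by rewrite /x10 update_neq.
have x10j : x10 j = u1 by rewrite /x10 update_eq.
have x11l : x11 l = y1 by rewrite /x11 update_eq.
have x11j : x11 j = u1 by rewrite /x11 update_neq// eq_sym.
have aj x (a : outcomes x) : (x l == y0) || (x l == y1) ->
    P c x a != 0 -> a j = e j (x j) (t (+) flip x).
  move=> xl Pa; have [s [-> al']] := corr _ _ xl Pa; congr (e _ _ _).
  have := al _ _ xl Pa; rewrite al' => /eI <-.
  by rewrite -addbA addbb addbF.
have [a Pa] := supp x10.
have /aj/(_ Pa) : (x10 l == y0) || (x10 l == y1) by rewrite x10l eqxx.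
have -> : flip x10 = false by rewrite /flip x10l (negbTE y01) andbF.
rewrite addbF => a10.
have x1011 : x10 j = x11 j by rewrite x10j x11j.
have [b Pb] := no_signalling_support
  (g := fun i y => e i y t) (bP c) nsP x1011 Pa a10.
have /aj/(_ Pb) -> : (x11 l == y0) || (x11 l == y1) by rewrite x11l eqxx orbT.
have -> : flip x11 by rewrite /flip x11l x11j !eqxx.
by move/eI; case: (t).
Qed.

End PRBox.

(** * A single party with a choice of settings *)

(** Lets outcomes at [x] be compared with outcomes at other setting strings; only its values at the
    settings of [x] are prescribed. *)
Definition extension (S : public_scenario) (x : settings S)
    (a : outcomes x) : strategy S :=
  projT1 (cid (response_onto a)).
Arguments extension {S x} a i.

Definition setting2 (S : public_scenario) (i : party S) : setting i :=
  Ordinal (nsettings_ge2 i).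

Section SingleFreeParty.
Context (R : realType) (S : public_scenario).

Lemma extensionE (x : settings S) (a : outcomes x) i :
  extension a i (x i) = a i.
Proof.
by rewrite /extension; case: cid => g ag /=; rewrite [in RHS]ag ffunE.
Qed.

Lemma eq_response_marginal (w : cond_probs R S) (V : {set party S}) g g' x :
  (forall i, i \in V -> g i (x i) = g' i (x i)) ->
  response_marginal w V g x = response_marginal w V g' x.
Proof.
move=> gg'; apply: eq_bigl => a; apply: eq_forallb_in => i iV.
by rewrite gg'.
Qed.

Lemma sum_tagged (i : party S) (y z : setting i) (u : outcome z) : z = y ->
  \sum_(v : outcome y)
     (Tagged (@outcome S i) u == Tagged (@outcome S i) v)%:R = 1 :> R.
Proof.
move=> zy; case: y / zy; under eq_bigr do rewrite eq_Tagged.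
exact: sum_dirac.
Qed.

Context (p : cond_probs R S) (bp : behaviour p) (nsp : no_signalling p).
Context (xb : settings S).

Let p0 x (a : outcomes x) : 0 <= p a. Proof. by case: (bp x). Qed.

Definition others_weight (i : party S) (b : outcomes xb) : R :=
  response_marginal p [set~ i]%SET (extension b) xb.

Definition joint_weight (i : party S) (y : setting i) (b : outcomes xb)
    (v : outcome y) : R :=
  \sum_(a : outcomes (update xb y) |
      [forall (k | k \in [set~ i]%SET), a k == extension b k (update xb y k)] &&
      (Tagged (@outcome S i) (a i) == Tagged (@outcome S i) v)) p a.

(** Conditional probability of [v] at setting [y] of [i], given that the others answer as in [b] at
    [xb]. If that event is null, a point mass keeps it a distribution; [b] then has probability
    0. *)
Definition conditional (i : party S) (y : setting i) (b : outcomes xb)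
    (v : outcome y) : R :=
  if others_weight i b == 0 then (extension b i y == v)%:R
  else joint_weight b v / others_weight i b.

Lemma others_weight_update (i : party S) (y : setting i) (g : strategy S) :
  response_marginal p [set~ i]%SET g (update xb y) =
  response_marginal p [set~ i]%SET g xb.
Proof. by apply: nsp => k; rewrite !inE => ki; rewrite update_neq. Qed.

Lemma is_distribution_conditional (i : party S) (y : setting i) b :
  is_distribution (@conditional i y b).
Proof.
split=> [v|].
  rewrite /conditional; case: ifP => // _.
  by rewrite divr_ge0// sumr_ge0.
rewrite /conditional; case: eqVneq => [_|D0]; first exact: sum_dirac.
rewrite -big_distrl/= -[RHS](divff D0); congr (_ / _).
rewrite /others_weight -(others_weight_update y).
rewrite /joint_weight (exchange_big_dep
  (fun a : outcomes (update xb y) => [forall (k | k \in [set~ i]%SET),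
     a k == extension b k (update xb y k)]))/=; last by move=> v a _ /andP[].
apply: eq_bigr => a ->; rewrite -[RHS]mulr1 -(sum_tagged (a i) (update_eq _ _)).
rewrite big_distrr/= big_mkcond; apply: eq_bigr => v _.
by case: ifP => _; rewrite ?mulr1 ?mulr0.
Qed.

Lemma conditionalE (i : party S) (y : setting i) b (v : outcome y) :
  p b * conditional b v = p b * (joint_weight b v / others_weight i b).
Proof.
rewrite /conditional; case: eqVneq => // D0.
suff -> : p b = 0 by rewrite !mul0r.
apply: (psumr_eq0P _ D0) => //; apply/forall_inP => k _.
by rewrite extensionE.
Qed.

Context (j : party S) (g : strategy S).
Arguments g : clear implicits.
Hypothesis friends : forall x (a : outcomes x) (i : party S), p a != 0 ->
  i != j -> x i = setting1 i -> a i = g i (x i).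

(** With the outcomes of all parties but [j] fixed beforehand, at setting 1 by [g] and at [xb] by
    [b], only the response of [j] is random. Averaging over [b] its conditional law given the others
    is the chain rule for [p]. *)
Lemma condition_on_others x (a : outcomes x) :
  (forall i, i != j -> x i != setting1 i -> x i = xb i) ->
  \sum_(b : outcomes xb) p b * (conditional b (a j) *
    \prod_(i | i != j)
      (a i == if x i == setting1 i then g i (x i) else extension b i (x i))%:R) =
  p a.
Proof.
move=> xxb; pose x' := update xb (x j).
have x'j : x' j = x j by rewrite /x' update_eq.
have x'E i : i != j -> x' i = xb i by move=> ij; rewrite /x' update_neq.
pose phi (b : outcomes xb) := [forall (i | (i != j) && (x i != setting1 i)),
  a i == extension b i (x i)].
(* Outside [V] the outcomes are determined by [g], so [p a] is a marginal on [V]; on [V] the strings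
   [x] and [x'] agree, and no-signalling moves this marginal to [x']. *)
pose V : {set party S} := [set i | (i == j) || (x i != setting1 i)]%SET.
(* If [a] contradicts the outcomes fixed by [g], both sides vanish. *)
have [/forall_inP C|] := boolP
    [forall (i | (i != j) && (x i == setting1 i)), a i == g i (x i)];
    last first.
  rewrite negb_forall_in => /exists_inP[i /andP[ij xi] aNg].
  rewrite big1 => [|b _].
    apply/esym/eqP; apply: contraNT aNg => /friends -> //; exact/eqP.
  by rewrite (bigD1 i)//= xi (negbTE aNg) mul0r !mulr0.
have -> : p a = response_marginal p V (extension a) x.
  rewrite /response_marginal (bigD1 a)/=; last first.
    by apply/forall_inP => i _; rewrite extensionE.
  rewrite big1 ?addr0// => a' /andP[/forall_inP a'V a'Na].
  apply: contraNeq a'Na => pa'; apply/eqP/ffunP => i.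
  have [iV|] := boolP (i \in V); first by rewrite (eqP (a'V _ iV)) extensionE.
  rewrite !inE negb_or negbK => /andP[ij xi].
  by rewrite (friends pa' ij (eqP xi)); apply/esym/eqP/C; rewrite ij.
have -> : response_marginal p V (extension a) x =
    response_marginal p V (extension a) x'.
  apply: nsp => i; rewrite !inE; have [->//|ij /= xi] := eqVneq i j.
  by rewrite xxb// x'E.
pose A (b : outcomes xb) (a' : outcomes x') :=
  [forall (k | k \in [set~ j]%SET), a' k == extension b k (x' k)].
pose T (a' : outcomes x') :=
  Tagged (@outcome S j) (a' j) == Tagged (@outcome S j) (a j).
transitivity (\sum_b \sum_(a' : outcomes x' | A b a' && T a')
    p b / others_weight j b * (phi b)%:R * p a').
  apply: eq_bigr => b _.
  have -> : \prod_(i | i != j)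
      (a i == if x i == setting1 i then g i (x i) else extension b i (x i))%:R
      = (phi b)%:R :> R.
    have [/forall_inP ab|] := boolP (phi b).
      rewrite big1// => i ij; case: ifPn => xi; first by rewrite C ?ij.
      by rewrite ab ?ij.
    rewrite negb_forall_in => /exists_inP[i /andP[ij xi] aNb].
    by rewrite (bigD1 i)//= (negbTE xi) (negbTE aNb) mul0r.
  rewrite mulrA conditionalE -big_distrr/= -/(joint_weight b (a j)).
  by rewrite -!mulrA; congr (_ * _); rewrite [LHS]mulrC -mulrA.
rewrite (exchange_big_dep T)/=; last by move=> b a' _ /andP[].
pose phi' (a' : outcomes x') := [forall (i | (i != j) && (x i != setting1 i)),
  a' i == extension a i (x' i)].
have -> : response_marginal p V (extension a) x' =
    \sum_(a' : outcomes x' | T a') (phi' a')%:R * p a'.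
  rewrite /response_marginal [LHS]big_mkcond [RHS]big_mkcond.
  apply: eq_bigr => a' _.
  have -> : T a' = (a' j == extension a j (x' j)).
    by rewrite /T -(extensionE a) -x'j eq_Tagged.
  case: eqP => [a'j|a'j].
    rewrite -[X in if _ then X else _]mul1r; case: forall_inP => [a'V|].
      suff -> : phi' a' by [].
      by apply/forall_inP => i /andP[_ xi]; apply: a'V; rewrite inE xi orbT.
    case: (boolP (phi' a')) => [/forall_inP ph []|]; last by rewrite mul0r.
    move=> i; rewrite inE; have [->|ij /= xi] := eqVneq i j.
      by rewrite a'j.
    by apply: ph; rewrite ij.
  case: forall_inP => // a'V; case: a'j; apply/eqP/a'V; by rewrite inE eqxx.
apply: eq_bigr => a' Ta'.
have [->|pa'] := eqVneq (p a') 0.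
  by rewrite mulr0 big1// => b _; rewrite mulr0.
(* For fixed [a'], the compatible [b] are those agreeing with [a'] off [j]. Their total weight is
   [D], which is also [others_weight j b] for each of them, so the quotients sum to 1. *)
pose D := response_marginal p [set~ j]%SET (extension a') xb.
have D0 : D != 0.
  rewrite /D -(others_weight_update (x j)).
  apply: (@sumr_ge0_neq0 _ _ _ _ a') => //.
  by apply/forall_inP => k _; rewrite extensionE.
have AE b : A b a' =
    [forall (k | k \in [set~ j]%SET), b k == extension a' k (xb k)].
  apply: eq_forallb_in => k; rewrite !inE => kj.
  by rewrite -(extensionE b) -(x'E k kj) -(extensionE a') eq_sym.
rewrite -big_distrl/=; congr (_ * _).
transitivity (\sum_(b | A b a') p b / D * (phi' a')%:R).
  apply: eq_big => [b|b /andP[Aba' _]]; first by rewrite Ta' andbT.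
  have {}Aba' k : k != j -> a' k = extension b k (x' k).
    by move=> kj; apply/eqP/(forall_inP Aba'); rewrite !inE.
  congr (_ / _ * (nat_of_bool _)%:R).
    apply: eq_response_marginal => k; rewrite !inE => kj.
    by rewrite -(x'E k kj) -Aba'// extensionE.
  apply: eq_forallb_in => i /andP[ij xi].
  rewrite Aba'// -(extensionE a).
  have -> : x i = x' i by rewrite xxb// x'E.
  by rewrite eq_sym.
rewrite -2!big_distrl/=.
have -> : \sum_(b | A b a') p b = D by exact: eq_bigl.
by rewrite divff// mul1r.
Qed.

End SingleFreeParty.

Lemma LF_single_free_lhv (R : realType) (S : public_scenario)
    (IF : {set party S}) (j : party S) :
  (forall i, i != j -> i \in IF) -> (forall i, i != j -> nsettings i = 2%N) ->
  LF R IF `<=` lhv R S.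
Proof.
move=> inIF m2 w [bw [Pc [P [dPc bP wE laP rfP]]]].
have nsP c := (local_agencyP (P c)).1 (laP c).
have [G GE] := friend_report_section IF.
(* A party other than [j] has two settings, so when not at setting 1 it is at [xb]. At [j] the
   choice of [xb] is arbitrary. *)
pose xb : settings S := @setting2 S.
have xbE (i : party S) (y : setting i) : i != j -> y != setting1 i -> y = xb i.
  move=> ij y1; apply/val_inj => /=; have : (y < 2)%N by rewrite -(m2 _ ij).
  by move: y1; rewrite -val_eqE/=; case: (nat_of_ord y) => [|[]].
(* The hidden variable consists of the friends' outcomes and a full outcome string at [xb]. *)
pose q (t : friend_outcomes IF * outcomes xb) := Pc t.1 * P t.1 xb t.2.
pose Q (i : party S) (y : setting i) (t : friend_outcomes IF * outcomes xb)
    (v : outcome y) : R :=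
  if i == j then conditional (P t.1) t.2 v
  else (v == if y == setting1 i then G t.1 i y else extension t.2 i y)%:R.
apply: (@fin_product_lhv _ _ _ q Q) => //.
- split=> [t|]; first by rewrite mulr_ge0 ?dPc.1//; case: (bP t.1 xb).
  rewrite -(pair_bigA _ (fun c b => Pc c * P c xb b))/= -[RHS]dPc.2.
  by apply: eq_bigr => c _; rewrite -big_distrr/= (bP c xb).2 mulr1.
- move=> i y t; rewrite /Q; case: eqP => _.
    exact: is_distribution_conditional.
  split=> [v|]; first exact: ler0n.
  by under eq_bigr do rewrite eq_sym; exact: sum_dirac.
move=> x a; rewrite wE.
rewrite -(pair_bigA _ (fun c b => Pc c * P c xb b *
  \prod_i Q i (x i) (c, b) (a i)))/=.
apply: eq_bigr => c _; rewrite mulrC.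
rewrite -(@condition_on_others _ _ _ (bP c) (nsP c) xb j (G c) _ x a).
- rewrite big_distrr; apply: eq_bigr => b _ /=.
  rewrite -mulrA; congr (_ * (_ * _)).
  rewrite [RHS](bigD1 j)//= {1}/Q eqxx; congr (_ * _).
  by apply: eq_bigr => i /negbTE ij; rewrite /Q ij.
- move=> x1 a1 i Pa1 ij x1i.
  apply: (@reports_friends_support _ _ IF (P c)) => //.
    by rewrite GE; exact: rfP.
  by rewrite inE inIF// x1i eqxx.
- by move=> i ij xi; exact: xbE.
Qed.

(** * Comparison of the two sets *)

Section Comparison.
Context (R : realType) (S : public_scenario).
Implicit Types IF : {set party S}.

Lemma subset_LF_single_free IF IF' (j : party S) :
  LF R IF `<=` LF R IF' -> j \in IF' -> j \notin IF ->
  forall i, i != j -> i \in IF /\ nsettings i = 2%N.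
Proof.
move=> sub jIF' jIF i ij; have [e eI] := two_outcomes S.
have s2 (k : party S) : setting2 k != setting1 k by [].
pose g : strategy S := fun k y => e k y true.
have no_box (y0 y1 : setting i) : y0 != y1 ->
    ~ (i \in IF -> (y0 != setting1 i) && (y1 != setting1 i)).
  move=> y01 yIF; apply: (pr_box_notin_LF eI ij (s2 j) y01 (g := g) jIF').
  apply: sub; exact: pr_box_LF.
have iIF : i \in IF.
  (* Without a friend, [i] may use any two settings in the box. *)
  apply: contrapT => iIF; apply: (no_box (setting2 i) (setting1 i)) => //.
split=> //; apply/eqP; rewrite eqn_leq nsettings_ge2 andbT leqNgt.
(* Counting from 0, [Ordinal m3] is the third setting: a box at settings 2 and 3 is not revealed by
   the friend of [i]. *)
apply/negP => m3; apply: (no_box (setting2 i) (Ordinal m3)) => //.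
Qed.

Lemma subset_LF_lhv IF IF' : LF R IF `<=` LF R IF' -> ~ (IF' \subset IF) ->
  exists j : party S, [/\ IF = [set~ j]%SET,
    forall i, i != j -> nsettings i = 2%N & LF R IF = lhv R S].
Proof.
move=> sub /negP/subsetPn[j jIF' jIF].
have H := subset_LF_single_free sub jIF' jIF.
exists j; split.
- apply/setP => i; rewrite !inE; have [->|/H[-> _]//] := eqVneq i j.
  exact/negbTE.
- by move=> i /H[].
- rewrite eqEsubset; split; last exact: lhv_LF.
  by apply: (@LF_single_free_lhv _ _ _ j) => i /H[].
Qed.

Lemma subset_LF_cases IF IF' : ~ (IF \subset IF') -> ~ (IF' \subset IF) ->
  LF R IF `<=` LF R IF' ->
  (lhv R S = LF R IF /\ LF R IF `<` LF R IF') \/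
  [/\ #|IF| = (nparties S).-1, #|IF'| = (nparties S).-1,
      forall i : party S, nsettings i = 2%N,
      LF R IF = LF R IF' & LF R IF' = lhv R S].
Proof.
move=> nsub nsub' sub.
have [j [IFE m2 LFE]] := subset_LF_lhv sub nsub'.
have [sub'|nsub''] := pselect (LF R IF' `<=` LF R IF); last by left.
right; have [j' [IFE' m2' LFE']] := subset_LF_lhv sub' nsub.
split; rewrite ?IFE ?IFE' ?cardsC1 ?card_ord -?IFE -?IFE' ?LFE ?LFE'//.
(* The exceptional parties [j] and [j'] differ, since otherwise [IF] and [IF'] would coincide; so
   every party is covered by [m2] or [m2']. *)
move=> i; have [ij|/m2//] := eqVneq i j; apply: m2'.
apply/eqP => ij'; apply: nsub; by rewrite IFE IFE' -ij -ij'.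
Qed.

End Comparison.

Theorem theorem20 (R : realType) (Sp : public_scenario)
    (IF IF' : {set party Sp}) (neqF : IF <> IF')
    (nsubF : ~ (IF \subset IF')) (nsubF' : ~ (IF' \subset IF)) :
  exactly_one3
    ([/\ #|IF| = (nparties Sp).-1, #|IF'| = (nparties Sp).-1,
         forall i : party Sp, nsettings i = 2%N,
         LF R IF = LF R IF' & LF R IF' = lhv R Sp])
    ((lhv R Sp = LF R IF /\ LF R IF `<` LF R IF') \/
     (lhv R Sp = LF R IF' /\ LF R IF' `<` LF R IF))
    (~ (LF R IF `<=` LF R IF') /\ ~ (LF R IF' `<=` LF R IF)).
Proof.
have strict (A B : set (cond_probs R Sp)) : A `<` B -> A <> B.
  by move=> [_ nBA] AB; apply: nBA; rewrite AB.
have [sub|nsub] := pselect (LF R IF `<=` LF R IF').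
  have [H|H] := subset_LF_cases nsubF nsubF' sub.
    apply: Or32; split; [|by left|by case].
    by case=> _ _ _ AB _; case: H => _ /strict.
  apply: Or31; split=> //; last by case.
  by case: H => _ _ _ AB _ [] [_ /strict]; rewrite AB.
have [sub'|nsub'] := pselect (LF R IF' `<=` LF R IF).
  have [H|H] := subset_LF_cases nsubF' nsubF sub'.
    apply: Or32; split; [|by right|by case].
    by case=> _ _ _ AB _; case: H => _ /strict; rewrite AB.
  by case: H => _ _ _ AB _; case: nsub; rewrite AB.
apply: Or33; split=> //; first by case=> _ _ _ AB _; case: nsub; rewrite AB.
by case=> [] [_ []].
Qed.
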